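(* Let $\mathbb{C}$ be a category with weak finite limits. If $\mathbb{C}$ has dependent full diagrams, then the exact completion $\mathbb{C}_{\mathrm{ex}}$ is locally cartesian closed.
   Context: Weak limits are defined as limits but without requiring uniqueness of the universal arrow; $\mathbb{C}$ has weak finite limits if every finite diagram has a weak limit. Dependent full diagram. Let $y\colon Y\to X$ and $x\colon X\to J$ be arrows in a category with weak finite limits. A dependent full diagram over $y,x$ consists of objects $U,V$ and arrows $u\colon U\to J$, $p_1\colon V\to U$, $p_2\colon V\to X$, $f\colon V\to Y$ such that $yf=p_2$, $up_1=xp_2$, the square $up_1=xp_2$ is a weak pullback, and the following holds: for every other such diagram over $y,x$ (objects $U',V'$, arrows $u'\colon U'\to J$, $p_1'\colon V'\to U'$, $p_2'\colon V'\to X$, $f'\colon V'\to Y$ with $yf'=p_2'$ and $u'p_1'=xp_2'$ a weak pullback square), there are an arrow $h\colon U'\to U$, a weak pullback $V\xleftarrow{q}P\xrightarrow{r}U'$ of $V\xrightarrow{p_1}U\xleftarrow{h}U'$ and an arrow $k\colon P\to V'$ such that $uh=u'$, $p_1'k=r$, $p_2'k=p_2q$ and $f'k=fq$. ''$\mathbb{C}$ has dependent full diagrams'' means there is one over every composable pair $Y\xrightarrow{y}X\xrightarrow{x}J$ in $\mathbb{C}$. Exact completion (ex/wlex completion). A pseudo equivalence relation in $\mathbb{C}$ is a parallel pair $r_1,r_2\colon R\rightrightarrows X$ (not necessarily jointly monic) that is reflexive (there is $\rho\colon X\to R$ with $r_1\rho=r_2\rho=\mathrm{id}_X$), symmetric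 (there is $\sigma\colon R\to R$ with $r_1\sigma=r_2$, $r_2\sigma=r_1$) and transitive (for a weak pullback $R\xleftarrow{a}T\xrightarrow{b}R$ of $r_2,r_1$, so $r_2a=r_1b$, there is $\tau\colon T\to R$ with $r_1\tau=r_1a$, $r_2\tau=r_2b$). Objects of $\mathbb{C}_{\mathrm{ex}}$ are the pseudo equivalence relations in $\mathbb{C}$; an arrow from $R\rightrightarrows X$ to $(s_1,s_2)\colon S\rightrightarrows Y$ is an equivalence class of arrows $f\colon X\to Y$ for which there is $\hat f\colon R\to S$ with $s_i\hat f=fr_i$ ($i=1,2$), where $f\sim f'$ if there is $t\colon X\to S$ with $s_1t=f$, $s_2t=f'$. $\mathbb{C}_{\mathrm{ex}}$ is a (Barr-)exact category with finite limits. *)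

(* Defs.v *)
From Stdlib Require Import List FinFun ProofIrrelevance.
From Stdlib Require Import FunctionalExtensionality PropExtensionality.

Set Implicit Arguments.
Unset Strict Implicit.

Declare Scope cat_scope.
Delimit Scope cat_scope with cat.

Record Category : Type := {
  Obj : Type;
  Hom : Obj -> Obj -> Type;
  id : forall A, Hom A A;
  comp : forall A B C, Hom B C -> Hom A B -> Hom A C;
  comp_assoc : forall A B C D (h : Hom C D) (g : Hom B C) (f : Hom A B),
    comp h (comp g f) = comp (comp h g) f;
  comp_id_l : forall A B (f : Hom A B), comp (id B) f = f;
  comp_id_r : forall A B (f : Hom A B), comp f (id A) = f
}.

Arguments Hom {c} A B.
Arguments id {c} A.
Arguments comp {c A B C} g f.
Arguments comp_assoc {c A B C D} h g f.
Arguments comp_id_l {c A B} f.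
Arguments comp_id_r {c A B} f.

Notation "g ∘ f" := (comp g f) (at level 40, left associativity) : cat_scope.
Local Open Scope cat_scope.

Record Functor (J C : Category) : Type := {
  fobj : Obj J -> Obj C;
  fmap : forall i j, @Hom J i j -> @Hom C (fobj i) (fobj j);
  fmap_id : forall i, fmap (id i) = id (fobj i);
  fmap_comp : forall i j k (b : @Hom J j k) (a : @Hom J i j),
    fmap (b ∘ a) = fmap b ∘ fmap a
}.

Arguments fobj {J C} f i.
Arguments fmap {J C} f {i j} a.

Definition finite_category (J : Category) : Prop :=
  Finite (Obj J) /\ forall i j : Obj J, Finite (Hom i j).

Section Limits.

Variables (J C : Category) (F : Functor J C).

Definition is_cone (L : Obj C) (l : forall i, Hom L (fobj F i)) : Prop :=
  forall i j (a : @Hom J i j), fmap F a ∘ l i = l j.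

Definition is_weak_limit (L : Obj C) (l : forall i, Hom L (fobj F i)) : Prop :=
  is_cone l /\
  forall (M : Obj C) (m : forall i, Hom M (fobj F i)), is_cone m ->
    exists h : Hom M L, forall i, l i ∘ h = m i.

Definition is_limit (L : Obj C) (l : forall i, Hom L (fobj F i)) : Prop :=
  is_cone l /\
  forall (M : Obj C) (m : forall i, Hom M (fobj F i)), is_cone m ->
    exists! h : Hom M L, forall i, l i ∘ h = m i.

End Limits.

Definition has_weak_finite_limits (C : Category) : Prop :=
  forall (J : Category) (F : Functor J C), finite_category J ->
    exists (L : Obj C) (l : forall i, Hom L (fobj F i)), is_weak_limit l.

Definition has_finite_limits (C : Category) : Prop :=
  forall (J : Category) (F : Functor J C), finite_category J ->
    exists (L : Obj C) (l : forall i, Hom L (fobj F i)), is_limit l.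

Definition is_weak_pullback (C : Category) (A B D P : Obj C)
    (f : Hom A D) (g : Hom B D) (p : Hom P A) (q : Hom P B) : Prop :=
  f ∘ p = g ∘ q /\
  forall (Z : Obj C) (a : Hom Z A) (b : Hom Z B), f ∘ a = g ∘ b ->
    exists h : Hom Z P, p ∘ h = a /\ q ∘ h = b.

Section DependentFullDiagrams.

Variable C : Category.

Record dependent_diagram (Y X J : Obj C) (y : Hom Y X) (x : Hom X J) : Type := {
  dd_U : Obj C;
  dd_V : Obj C;
  dd_u : Hom dd_U J;
  dd_p1 : Hom dd_V dd_U;
  dd_p2 : Hom dd_V X;
  dd_f : Hom dd_V Y;
  dd_section : y ∘ dd_f = dd_p2;
  dd_wpb : is_weak_pullback dd_u x dd_p1 dd_p2
}.

Definition is_full (Y X J : Obj C) (y : Hom Y X) (x : Hom X J)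
    (d : dependent_diagram y x) : Prop :=
  forall d' : dependent_diagram y x,
    exists (h : Hom (dd_U d') (dd_U d)) (P : Obj C)
      (q : Hom P (dd_V d)) (r : Hom P (dd_U d')) (k : Hom P (dd_V d')),
      is_weak_pullback (dd_p1 d) h q r /\
      dd_u d ∘ h = dd_u d' /\
      dd_p1 d' ∘ k = r /\
      dd_p2 d' ∘ k = dd_p2 d ∘ q /\
      dd_f d' ∘ k = dd_f d ∘ q.

Definition has_dependent_full_diagrams : Prop :=
  forall (Y X J : Obj C) (y : Hom Y X) (x : Hom X J),
    exists d : dependent_diagram y x, is_full d.

End DependentFullDiagrams.

Section ExactCompletion.

Variable C : Category.

(* Any two weak pullbacks of the same cospan factor through each other, so
   transitivity does not depend on which one is used. *)
Record pseudo_eqrel : Type := {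
  per_X : Obj C;
  per_R : Obj C;
  per_r1 : Hom per_R per_X;
  per_r2 : Hom per_R per_X;
  per_refl : exists rho : Hom per_X per_R,
    per_r1 ∘ rho = id per_X /\ per_r2 ∘ rho = id per_X;
  per_sym : exists sigma : Hom per_R per_R,
    per_r1 ∘ sigma = per_r2 /\ per_r2 ∘ sigma = per_r1;
  per_trans : exists (T : Obj C) (a b : Hom T per_R) (tau : Hom T per_R),
    is_weak_pullback per_r2 per_r1 a b /\
    per_r1 ∘ tau = per_r1 ∘ a /\ per_r2 ∘ tau = per_r2 ∘ b
}.

Definition ex_tracked (R S : pseudo_eqrel) (f : Hom (per_X R) (per_X S)) : Prop :=
  exists f' : Hom (per_R R) (per_R S),
    per_r1 S ∘ f' = f ∘ per_r1 R /\ per_r2 S ∘ f' = f ∘ per_r2 R.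

Definition ex_sim (R S : pseudo_eqrel) (f g : Hom (per_X R) (per_X S)) : Prop :=
  exists t : Hom (per_X R) (per_R S), per_r1 S ∘ t = f /\ per_r2 S ∘ t = g.

Definition ex_class (R S : pseudo_eqrel) (f : Hom (per_X R) (per_X S)) :
    Hom (per_X R) (per_X S) -> Prop :=
  fun g => ex_tracked g /\ ex_sim f g.

Record ex_hom (R S : pseudo_eqrel) : Type := {
  ex_mem : Hom (per_X R) (per_X S) -> Prop;
  ex_memP : exists f, ex_tracked f /\ ex_mem = ex_class f
}.

Lemma ex_hom_eq (R S : pseudo_eqrel) (F G : ex_hom R S) :
  ex_mem F = ex_mem G -> F = G.
Proof.
  destruct F as [F HF], G as [G HG]; simpl; intros <-.
  now rewrite (proof_irrelevance _ HF HG).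
Qed.

Definition ex_of (R S : pseudo_eqrel) (f : Hom (per_X R) (per_X S))
    (hf : ex_tracked f) : ex_hom R S :=
  {| ex_mem := ex_class f; ex_memP := ex_intro _ f (conj hf eq_refl) |}.

Lemma ex_hom_of (R S : pseudo_eqrel) (F : ex_hom R S) :
  exists f (hf : ex_tracked f), F = ex_of hf.
Proof.
  destruct (ex_memP F) as [f [hf e]].
  exists f, hf. now apply ex_hom_eq.
Qed.

Section SimEquivalence.
Variables R S : pseudo_eqrel.
Implicit Types f g h : Hom (per_X R) (per_X S).

Lemma ex_sim_refl f : ex_sim f f.
Proof.
  destruct (per_refl S) as [rho [e1 e2]].
  exists (rho ∘ f). rewrite !comp_assoc, e1, e2, comp_id_l. now split.
Qed.

Lemma ex_sim_sym f g : ex_sim f g -> ex_sim g f.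
Proof.
  intros [t [e1 e2]]. destruct (per_sym S) as [sg [s1 s2]].
  exists (sg ∘ t). rewrite !comp_assoc, s1, s2. now split.
Qed.

Lemma ex_sim_trans f g h : ex_sim f g -> ex_sim g h -> ex_sim f h.
Proof.
  intros [t [e1 e2]] [s [d1 d2]].
  destruct (per_trans S) as [T [a [b [tau [[_ wp] [t1 t2]]]]]].
  destruct (wp _ t s) as [k [k1 k2]]; [congruence|].
  exists (tau ∘ k). rewrite !comp_assoc, t1, t2, <- !comp_assoc, k1, k2.
  now split.
Qed.

Lemma ex_of_eq f g (hf : ex_tracked f) (hg : ex_tracked g) :
  ex_of hf = ex_of hg <-> ex_sim f g.
Proof.
  split.
  - intros e. assert (H : ex_class f g).
    { change (ex_mem (ex_of hf) g). rewrite e. split; [exact hg|].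
      apply ex_sim_refl. }
    exact (proj2 H).
  - intros e. apply ex_hom_eq; simpl.
    apply functional_extensionality; intros h; apply propositional_extensionality.
    split; intros [th s]; split; try exact th.
    + exact (ex_sim_trans (ex_sim_sym e) s).
    + exact (ex_sim_trans e s).
Qed.

End SimEquivalence.

Lemma ex_tracked_id (R : pseudo_eqrel) : ex_tracked (R := R) (S := R) (id _).
Proof.
  exists (id _). rewrite !comp_id_l, !comp_id_r. now split.
Qed.

Lemma ex_tracked_comp (R S T : pseudo_eqrel)
    (g : Hom (per_X S) (per_X T)) (f : Hom (per_X R) (per_X S)) :
  ex_tracked g -> ex_tracked f -> ex_tracked (R := R) (S := T) (g ∘ f).
Proof.
  intros [g' [g1 g2]] [f' [f1 f2]].
  exists (g' ∘ f').
  rewrite !comp_assoc, g1, g2, <- !comp_assoc, f1, f2. now split.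
Qed.

Lemma ex_sim_comp (R S T : pseudo_eqrel)
    (g g' : Hom (per_X S) (per_X T)) (f f' : Hom (per_X R) (per_X S)) :
  ex_tracked g -> ex_sim f f' -> ex_sim g g' ->
  ex_sim (R := R) (S := T) (g ∘ f) (g' ∘ f').
Proof.
  intros [gh [g1 g2]] [t [t1 t2]] [s [s1 s2]].
  apply (@ex_sim_trans R T _ (g ∘ f')).
  - exists (gh ∘ t). rewrite !comp_assoc, g1, g2, <- !comp_assoc, t1, t2.
    now split.
  - exists (s ∘ f'). rewrite !comp_assoc, s1, s2. now split.
Qed.

Definition ex_comp_mem (R S T : pseudo_eqrel) (G : ex_hom S T) (F : ex_hom R S) :
    Hom (per_X R) (per_X T) -> Prop :=
  fun h => exists g f, ex_mem G g /\ ex_mem F f /\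
    ex_class (R := R) (S := T) (g ∘ f) h.

Lemma ex_comp_memE (R S T : pseudo_eqrel)
    (g : Hom (per_X S) (per_X T)) (f : Hom (per_X R) (per_X S))
    (hg : ex_tracked g) (hf : ex_tracked f) :
  ex_comp_mem (ex_of hg) (ex_of hf) = ex_class (R := R) (S := T) (g ∘ f).
Proof.
  apply functional_extensionality; intros h; apply propositional_extensionality.
  split.
  - intros [g' [f' [[_ sg] [[_ sf] [th s]]]]].
    split; [exact th|].
    apply (@ex_sim_trans R T _ (g' ∘ f')); [|exact s].
    now apply ex_sim_comp.
  - intros H. exists g, f.
    split; [|split]; [split; [assumption|apply ex_sim_refl] ..|exact H].
Qed.

Lemma ex_comp_memP (R S T : pseudo_eqrel) (G : ex_hom S T) (F : ex_hom R S) :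
  exists h, ex_tracked h /\ ex_comp_mem G F = ex_class h.
Proof.
  destruct (ex_hom_of G) as [g [hg ->]], (ex_hom_of F) as [f [hf ->]].
  exists (g ∘ f). split; [now apply ex_tracked_comp|apply ex_comp_memE].
Qed.

Definition ex_comp (R S T : pseudo_eqrel) (G : ex_hom S T) (F : ex_hom R S) :
    ex_hom R T :=
  {| ex_mem := ex_comp_mem G F; ex_memP := ex_comp_memP G F |}.

Lemma ex_comp_of (R S T : pseudo_eqrel)
    (g : Hom (per_X S) (per_X T)) (f : Hom (per_X R) (per_X S))
    (hg : ex_tracked g) (hf : ex_tracked f) :
  ex_comp (ex_of hg) (ex_of hf) = ex_of (ex_tracked_comp hg hf).
Proof. apply ex_hom_eq, ex_comp_memE. Qed.

Definition ex_id (R : pseudo_eqrel) : ex_hom R R := ex_of (ex_tracked_id R).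

Lemma ex_comp_assoc (A B D E : pseudo_eqrel)
    (H : ex_hom D E) (G : ex_hom B D) (F : ex_hom A B) :
  ex_comp H (ex_comp G F) = ex_comp (ex_comp H G) F.
Proof.
  destruct (ex_hom_of H) as [h [hh ->]], (ex_hom_of G) as [g [hg ->]],
    (ex_hom_of F) as [f [hf ->]].
  rewrite !ex_comp_of. apply ex_of_eq. rewrite comp_assoc. apply ex_sim_refl.
Qed.

Lemma ex_comp_id_l (A B : pseudo_eqrel) (F : ex_hom A B) : ex_comp (ex_id B) F = F.
Proof.
  destruct (ex_hom_of F) as [f [hf ->]]. unfold ex_id.
  rewrite ex_comp_of. apply ex_of_eq. rewrite comp_id_l. apply ex_sim_refl.
Qed.

Lemma ex_comp_id_r (A B : pseudo_eqrel) (F : ex_hom A B) : ex_comp F (ex_id A) = F.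
Proof.
  destruct (ex_hom_of F) as [f [hf ->]]. unfold ex_id.
  rewrite ex_comp_of. apply ex_of_eq. rewrite comp_id_r. apply ex_sim_refl.
Qed.

Definition exact_completion : Category := {|
  Obj := pseudo_eqrel;
  Hom := ex_hom;
  id := ex_id;
  comp := ex_comp;
  comp_assoc := ex_comp_assoc;
  comp_id_l := ex_comp_id_l;
  comp_id_r := ex_comp_id_r
|}.

End ExactCompletion.

Section Slice.

Variables (D : Category) (X : Obj D).

Record slice_obj : Type := {
  sl_dom : Obj D;
  sl_arr : Hom sl_dom X
}.

Record slice_hom (A B : slice_obj) : Type := {
  sl_hom : Hom (sl_dom A) (sl_dom B);
  sl_homP : sl_arr B ∘ sl_hom = sl_arr A
}.

Lemma slice_hom_eq (A B : slice_obj) (f g : slice_hom A B) :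
  sl_hom f = sl_hom g -> f = g.
Proof.
  destruct f as [f hf], g as [g hg]; simpl; intros <-.
  now rewrite (proof_irrelevance _ hf hg).
Qed.

Definition slice_id (A : slice_obj) : slice_hom A A :=
  {| sl_hom := id _; sl_homP := comp_id_r (sl_arr A) |}.

Lemma slice_compP (A B E : slice_obj) (g : slice_hom B E) (f : slice_hom A B) :
  sl_arr E ∘ (sl_hom g ∘ sl_hom f) = sl_arr A.
Proof. now rewrite comp_assoc, sl_homP, sl_homP. Qed.

Definition slice_comp (A B E : slice_obj) (g : slice_hom B E) (f : slice_hom A B) :
    slice_hom A E :=
  {| sl_hom := sl_hom g ∘ sl_hom f; sl_homP := slice_compP g f |}.

Lemma slice_comp_assoc (A B E G : slice_obj)
    (h : slice_hom E G) (g : slice_hom B E) (f : slice_hom A B) :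
  slice_comp h (slice_comp g f) = slice_comp (slice_comp h g) f.
Proof. apply slice_hom_eq, comp_assoc. Qed.

Lemma slice_comp_id_l (A B : slice_obj) (f : slice_hom A B) :
  slice_comp (slice_id B) f = f.
Proof. apply slice_hom_eq, comp_id_l. Qed.

Lemma slice_comp_id_r (A B : slice_obj) (f : slice_hom A B) :
  slice_comp f (slice_id A) = f.
Proof. apply slice_hom_eq, comp_id_r. Qed.

Definition slice : Category := {|
  Obj := slice_obj;
  Hom := slice_hom;
  id := slice_id;
  comp := slice_comp;
  comp_assoc := slice_comp_assoc;
  comp_id_l := slice_comp_id_l;
  comp_id_r := slice_comp_id_r
|}.

End Slice.

Section CartesianClosed.

Variable D : Category.

Definition is_terminal (T : Obj D) : Prop :=
  forall A : Obj D, exists! f : Hom A T, True.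

Definition is_product (A B P : Obj D) (p1 : Hom P A) (p2 : Hom P B) : Prop :=
  forall (Z : Obj D) (a : Hom Z A) (b : Hom Z B),
    exists! h : Hom Z P, p1 ∘ h = a /\ p2 ∘ h = b.

(* [P] is a product E × A and [m] is h × id_A : Z × A -> E × A, for any choice
   of the product [Q] = Z × A. *)
Definition is_exponential (A B E P : Obj D)
    (p1 : Hom P E) (p2 : Hom P A) (ev : Hom P B) : Prop :=
  is_product p1 p2 /\
  forall (Z Q : Obj D) (q1 : Hom Q Z) (q2 : Hom Q A), is_product q1 q2 ->
  forall g : Hom Q B,
    exists! h : Hom Z E,
      exists m : Hom Q P, p1 ∘ m = h ∘ q1 /\ p2 ∘ m = q2 /\ ev ∘ m = g.

Definition cartesian_closed : Prop :=
  (exists T : Obj D, is_terminal T) /\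
  (forall A B : Obj D, exists (P : Obj D) (p1 : Hom P A) (p2 : Hom P B),
    is_product p1 p2) /\
  (forall A B : Obj D, exists (E P : Obj D) (p1 : Hom P E) (p2 : Hom P A)
    (ev : Hom P B), is_exponential p1 p2 ev).

End CartesianClosed.

Definition locally_cartesian_closed (D : Category) : Prop :=
  has_finite_limits D /\ forall X : Obj D, cartesian_closed (slice X).

(* Main.v *)
From Stdlib Require Import List FinFun ProofIrrelevance IndefiniteDescription Classical.
From Stdlib Require Import Setoid Morphisms.
Require Import Defs.

(** Write [X] for the carrier of an object of the completion and regard an arrow [Z -> X] of [C]
    as an element of it at stage [Z]. The pseudo equivalence relation then gives an equivalence
    [sim] on the elements at each stage, an arrow of the completion is represented by a map of
    elements that respects [sim] ([tracked_iff]), and two arrows are equal when their values are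
    [sim]. Weak finite limits in [C] turn predicates on elements into objects: the predicates that
    amount to factoring through a fixed arrow ([comprehensible]) are closed under equations,
    [sim], finite conjunction and existential quantification, and every comprehensible equivalence
    relation is the [sim] of some object ([per_of_comprehensible]). Finite limits, in particular
    pullbacks, are obtained by writing down their elements.

    Dependent full diagrams enter twice. They make comprehensible predicates closed under
    universal quantification along an arrow of [C] ([comprehensible_forall_along]). And they say
    that for [A] and [B] over [X] there is an object [U] over [X] that codes total relations from
    the fibres of [A] to those of [B], in such a way that every total relation contains a coded
    one ([full_total_relations]). This is how function sets are obtained from fullness in
    constructive set theory. The codes of single-valued relations form a comprehensible part of
    [U], and coding the same function is a comprehensible equivalence on it, since both conditions
    are universal quantifications ([comprehensible_same_values]). The quotient is the exponential
    of [B] by [A] over [X]: the graph of an arrow [N × A -> B] is a total relation, so it contains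
    a coded one, and an inclusion between graphs of functions is an equality
    ([functional_relation_classifier]). *)

Set Implicit Arguments.
Unset Strict Implicit.
Local Open Scope cat_scope.

(** * Weak products, weak equalizers and weak pullbacks *)

Section DiscreteCategory.
Variable I : Type.

Definition discrete : Category.
Proof.
  refine {| Obj := I; Hom := fun i j => i = j; id := @eq_refl I;
            comp := fun i j k b a => eq_trans a b |};
    intros; apply proof_irrelevance.
Defined.

(** [Finite] asks for a list of all arrows, so equality of objects has to be decided. *)
Lemma discrete_finite : Finite I -> finite_category discrete.
Proof.
  intros HI; split; [exact HI|]. simpl. intros i j.
  destruct (classic (i = j)) as [e|n].
  - exists (e :: nil). intros e'. left. apply proof_irrelevance.
  - exists nil. intros e. now destruct n.
Qed.

Definition discrete_functor (C : Category) (X : I -> Obj C) : Functor discrete C.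
Proof.
  refine {| fobj := X : Obj discrete -> Obj C;
            fmap := fun i j (e : i = j) =>
              match e in _ = j return Hom (X i) (X j) with eq_refl => id (X i) end |}.
  - reflexivity.
  - intros i j k b a. simpl in b. destruct b. simpl. now rewrite comp_id_l.
Defined.

End DiscreteCategory.

Section ParallelPairCategory.

(** Weak equalizers need a shape of their own: pairing into a weak product is not unique, which breaks
    the usual derivation of equalizers from products and pullbacks. Here [false] is the common
    source and [true] the common target. *)
Definition pair_hom (i j : bool) : Type :=
  match i, j with
  | false, true => bool
  | true, false => Empty_set
  | _, _ => unit
  end.

Definition pair_id (i : bool) : pair_hom i i :=
  match i with true => tt | false => tt end.

Definition pair_comp (i j k : bool) : pair_hom j k -> pair_hom i j -> pair_hom i k :=
  match i, j, k with
  | false, false, false => fun _ _ => tt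
  | false, false, true => fun b _ => b
  | false, true, true => fun _ a => a
  | true, true, true => fun _ _ => tt
  | false, true, false => fun _ _ => tt
  | true, false, _ => fun _ a => match a with end
  | true, true, false => fun b _ => b
  end.

Definition parallel_pair : Category.
Proof.
  refine {| Obj := bool; Hom := pair_hom; id := pair_id; comp := pair_comp |};
    repeat intros []; simpl; try reflexivity; try intros []; try reflexivity;
    try intros []; try reflexivity; try intros []; reflexivity.
Defined.

Lemma parallel_pair_finite : finite_category parallel_pair.
Proof.
  split.
  - exists (true :: false :: nil). intros []; simpl; auto.
  - intros [] []; simpl.
    + exists (tt :: nil). intros []; simpl; auto.
    + exists nil. intros [].
    + exists (true :: false :: nil). intros []; simpl; auto.
    + exists (tt :: nil). intros []; simpl; auto.
Qed.

Definition parallel_pair_functor (C : Category) (A B : Obj C) (f g : Hom A B) :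
  Functor parallel_pair C.
Proof.
  refine {| fobj := (fun i : bool => if i then B else A) : Obj parallel_pair -> Obj C;
            fmap := fun i j =>
              match i, j return pair_hom i j -> Hom (if i then B else A) (if j then B else A) with
              | false, true => fun b : bool => if b then f else g
              | true, false => fun a => match a with end
              | false, false => fun _ => id A
              | true, true => fun _ => id B
              end |}.
  - intros []; reflexivity.
  - intros [] [] []; simpl; intros; try contradiction;
      rewrite ?comp_id_l, ?comp_id_r; reflexivity.
Defined.

End ParallelPairCategory.

Section WeakLimits.
Variable C : Category.
Hypothesis weak_lims : has_weak_finite_limits C.

(** The lifting arrow is a weak limit's, so [c] is not unique and nothing says that two arrows
    into [P] with equal components are equal. *)
Lemma weak_product_family (I : Type) (X : I -> Obj C) : Finite I ->
  exists (P : Obj C) (p : forall i, Hom P (X i)),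
    forall Z (a : forall i, Hom Z (X i)), exists c : Hom Z P, forall i, p i ∘ c = a i.
Proof.
  intros HI.
  destruct (weak_lims (discrete_functor X) (discrete_finite HI)) as [P [p [_ Hp]]].
  exists P, p. intros Z a. apply (Hp Z a).
  intros i j e. simpl in e. destruct e. apply comp_id_l.
Qed.

Lemma weak_product (A B : Obj C) :
  exists (P : Obj C) (p1 : Hom P A) (p2 : Hom P B),
    forall Z (a : Hom Z A) (b : Hom Z B), exists c : Hom Z P, p1 ∘ c = a /\ p2 ∘ c = b.
Proof.
  destruct (@weak_product_family bool (fun i => if i then A else B)) as [P [p Hp]].
  { exists (true :: false :: nil). intros []; simpl; auto. }
  exists P, (p true), (p false). intros Z a b.
  destruct (Hp Z (fun i => if i return Hom Z (if i then A else B) then a else b)) as [c Hc].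
  exists c. exact (conj (Hc true) (Hc false)).
Qed.

(** * Predicates on generalised elements *)

(** An arrow [Z -> A] is read as an element of [A] at stage [Z]. A predicate on such elements is
    comprehensible when it is the image of a representable, that is, when holding of [a] means
    factoring through one fixed [k]. Weak limits give exactly this much. Since [k] may fail to be
    monic, existential quantification is just composition of [k] with a projection. Stated as an
    equivalence, the condition includes stability under precomposition. *)
Definition comprehensible (A : Obj C) (φ : forall Z, Hom Z A -> Prop) : Prop :=
  exists K (k : Hom K A), forall Z (a : Hom Z A), φ Z a <-> exists t, k ∘ t = a.

Definition comprehensible2 (A B : Obj C) (φ : forall Z, Hom Z A -> Hom Z B -> Prop) : Prop :=
  exists K (k1 : Hom K A) (k2 : Hom K B), forall Z (a : Hom Z A) (b : Hom Z B),
    φ Z a b <-> exists t, k1 ∘ t = a /\ k2 ∘ t = b.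

Lemma comprehensible_iff (A : Obj C) (φ ψ : forall Z, Hom Z A -> Prop) :
  (forall Z a, φ Z a <-> ψ Z a) -> comprehensible φ -> comprehensible ψ.
Proof.
  intros H [K [k Hk]]. exists K, k. intros Z a. now rewrite <- H.
Qed.

Lemma comprehensible_true (A : Obj C) : comprehensible (fun Z (_ : Hom Z A) => True).
Proof.
  exists A, (id A). intros Z a; split; [|trivial].
  intros _. exists a. apply comp_id_l.
Qed.

Lemma comprehensible_eq (A D : Obj C) (f g : Hom A D) :
  comprehensible (fun Z a => f ∘ a = g ∘ a).
Proof.
  destruct (weak_lims (parallel_pair_functor f g) parallel_pair_finite) as [E [e [He1 He2]]].
  exists E, (e false). intros Z a; split.
  - intros H.
    destruct (He2 Z (fun i => match i return Hom Z (if i then D else A) with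
      true => f ∘ a | false => a end)) as [t Ht].
    + intros [] []; simpl; try contradiction; intros b; try apply comp_id_l.
      now destruct b.
    + exists t. exact (Ht false).
  - intros [t <-]. rewrite !comp_assoc. f_equal.
    transitivity (e true).
    + exact (He1 false true true).
    + symmetry. exact (He1 false true false).
Qed.

Lemma weak_pullback (A B D : Obj C) (f : Hom A D) (g : Hom B D) :
  exists P (p : Hom P A) (q : Hom P B), is_weak_pullback f g p q.
Proof.
  destruct (weak_product A B) as [Q [p [q HQ]]].
  destruct (comprehensible_eq (f ∘ p) (g ∘ q)) as [K [k Hk]].
  exists K, (p ∘ k), (q ∘ k). split.
  - rewrite !comp_assoc. apply Hk. exists (id K). apply comp_id_r.
  - intros Z a b e. destruct (HQ Z a b) as [c [<- <-]].
    rewrite !comp_assoc in e. apply Hk in e. destruct e as [t <-].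
    exists t. rewrite !comp_assoc. now split.
Qed.

Lemma comprehensible_and (A : Obj C) (φ ψ : forall Z, Hom Z A -> Prop) :
  comprehensible φ -> comprehensible ψ -> comprehensible (fun Z a => φ Z a /\ ψ Z a).
Proof.
  intros [K [k Hk]] [L [l Hl]].
  destruct (weak_pullback k l) as [P [p [q [e HP]]]].
  exists P, (k ∘ p). intros Z a. rewrite Hk, Hl. split.
  - intros [[s <-] [t et]]. destruct (HP Z s t (eq_sym et)) as [c [<- _]].
    exists c. now rewrite comp_assoc.
  - intros [t <-]. split; [exists (p ∘ t)|exists (q ∘ t)]; rewrite comp_assoc; congruence.
Qed.

Lemma comprehensible_forall_finite (I : Type) (A : Obj C) (φ : I -> forall Z, Hom Z A -> Prop) :
  Finite I -> (forall i, comprehensible (φ i)) ->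
  comprehensible (fun Z a => forall i, φ i Z a).
Proof.
  intros [l Hl] H.
  apply (@comprehensible_iff A (fun Z a => forall i, In i l -> φ i Z a)).
  { intros Z a; split; auto. }
  clear Hl. induction l as [|i l IH].
  - apply (@comprehensible_iff A (fun _ _ => True)); [simpl; firstorder|apply comprehensible_true].
  - apply (@comprehensible_iff A (fun Z a => φ i Z a /\ forall j, In j l -> φ j Z a)).
    + intros Z a; split; [|firstorder].
      intros [Hi Hj] j [<-|Hin]; auto.
    + now apply comprehensible_and.
Qed.

(** A binary predicate is treated as a unary one on a weak product. Pairing is not
    unique there, but the predicate only sees the two components. *)
Lemma comprehensible_pair (A B : Obj C) (φ : forall Z, Hom Z A -> Hom Z B -> Prop) :
  (forall P (p1 : Hom P A) (p2 : Hom P B), comprehensible (fun Z c => φ Z (p1 ∘ c) (p2 ∘ c))) ->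
  comprehensible2 φ.
Proof.
  intros H. destruct (weak_product A B) as [P [p1 [p2 HP]]].
  destruct (H P p1 p2) as [K [k Hk]].
  exists K, (p1 ∘ k), (p2 ∘ k). intros Z a b; split.
  - intros Hab. destruct (HP Z a b) as [c [<- <-]].
    apply Hk in Hab. destruct Hab as [t <-].
    exists t. now rewrite !comp_assoc.
  - intros [t [<- <-]]. rewrite <- !comp_assoc. apply Hk. now exists t.
Qed.

Lemma comprehensible_exists (A B : Obj C) (φ : forall Z, Hom Z A -> Hom Z B -> Prop) :
  comprehensible2 φ -> comprehensible (fun Z a => exists b, φ Z a b).
Proof.
  intros [K [k1 [k2 Hk]]]. exists K, k1. intros Z a; split.
  - intros [b Hab]. apply Hk in Hab. destruct Hab as [t [e _]]. now exists t.
  - intros [t <-]. exists (k2 ∘ t). apply Hk. now exists t.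
Qed.

(** [ex_sim] is the case in which [Z] underlies an object of the completion. Allowing every stage
    lets arrows be tested on generic elements. *)
Definition sim (R : pseudo_eqrel C) (Z : Obj C) (a b : Hom Z (per_X R)) : Prop :=
  exists t : Hom Z (per_R R), per_r1 R ∘ t = a /\ per_r2 R ∘ t = b.

Lemma comprehensible_sim (R : pseudo_eqrel C) (A : Obj C) (f g : Hom A (per_X R)) :
  comprehensible (fun Z a => sim (f ∘ a) (g ∘ a)).
Proof.
  apply comprehensible_exists, comprehensible_pair. intros P p1 p2.
  apply (@comprehensible_iff P (fun Z c =>
    (per_r1 R ∘ p2) ∘ c = (f ∘ p1) ∘ c /\ (per_r2 R ∘ p2) ∘ c = (g ∘ p1) ∘ c)).
  - intros Z c. now rewrite !comp_assoc.
  - apply comprehensible_and; apply comprehensible_eq.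
Qed.

(** Dependent full diagrams provide universal quantification along [x]. Let [Y] comprehend [ψ] and
    take a full diagram over [Y -> X -> J], with base [u : U -> J]. An element of [U] carries a
    section of [Y] over the fibre, so factoring through [u] forces [ψ] on the fibre. Conversely,
    if [ψ] holds on the fibre over [j], that fibre with the resulting map to [Y] is a competing
    diagram, and fullness makes [j] factor through [u]. *)
Lemma comprehensible_forall_along (X J : Obj C) (x : Hom X J) (ψ : forall Z, Hom Z X -> Prop) :
  has_dependent_full_diagrams C -> comprehensible ψ ->
  comprehensible (fun Z (j : Hom Z J) =>
    forall Z' (s : Hom Z' Z) (c : Hom Z' X), x ∘ c = j ∘ s -> ψ Z' c).
Proof.
  intros full [Y [y Hy]].
  destruct (full _ _ _ y x) as [[U V u p1 p2 f ef wpb] Hfull].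
  exists U, u. intros Z j; split.
  - intros H. destruct (weak_pullback j x) as [V' [p1' [p2' Hwpb]]].
    (* The generic element of the fibre over [j]; every other one is a restriction of it. *)
    assert (Hs : ψ V' p2') by (apply (H V' p1'); symmetry; apply Hwpb).
    apply Hy in Hs. destruct Hs as [f' ef'].
    destruct (Hfull {| dd_section := ef'; dd_wpb := Hwpb |})
      as [h [P [q [r [k [_ [eh _]]]]]]].
    simpl in *. now exists h.
  - intros [t <-] Z' s c e. apply Hy.
    pose proof (proj2 wpb) as lift.
    destruct (lift Z' (t ∘ s) c) as [v [_ ev]]; [now rewrite e, comp_assoc|].
    exists (f ∘ v). now rewrite comp_assoc, ef.
Qed.

End WeakLimits.

(** * Arrows of the exact completion as maps of elements *)

Section Sim.
Variable C : Category.
Implicit Types R : pseudo_eqrel C.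

Lemma sim_refl R Z (a : Hom Z (per_X R)) : sim a a.
Proof.
  destruct (per_refl R) as [rho [e1 e2]].
  exists (rho ∘ a). rewrite !comp_assoc, e1, e2, comp_id_l. now split.
Qed.

Lemma sim_sym R Z (a b : Hom Z (per_X R)) : sim a b -> sim b a.
Proof.
  intros [t [<- <-]]. destruct (per_sym R) as [sg [s1 s2]].
  exists (sg ∘ t). rewrite !comp_assoc, s1, s2. now split.
Qed.

Lemma sim_trans R Z (a b c : Hom Z (per_X R)) : sim a b -> sim b c -> sim a c.
Proof.
  intros [t [<- e]] [s [e' <-]].
  destruct (per_trans R) as [T [p [q [tau [[_ lift] [t1 t2]]]]]].
  destruct (lift Z t s) as [k [k1 k2]]; [congruence|].
  exists (tau ∘ k). rewrite !comp_assoc, t1, t2, <- !comp_assoc, k1, k2.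
  now split.
Qed.

Lemma sim_precomp R Z Z' (a b : Hom Z (per_X R)) (s : Hom Z' Z) :
  sim a b -> sim (a ∘ s) (b ∘ s).
Proof. intros [t [<- <-]]. exists (t ∘ s). now rewrite !comp_assoc. Qed.

End Sim.

#[local] Instance sim_equivalence (C : Category) (R : pseudo_eqrel C) (Z : Obj C) :
  Equivalence (@sim C R Z).
Proof.
  split; [exact (@sim_refl C R Z)|exact (@sim_sym C R Z)|exact (@sim_trans C R Z)].
Qed.

Section Representatives.
Variable C : Category.
Implicit Types R S : pseudo_eqrel C.

(** A Yoneda argument: a tracking is the value at the generic pair [(r1, r2)]. *)
Lemma tracked_iff R S (f : Hom (per_X R) (per_X S)) :
  ex_tracked f <-> forall Z (a b : Hom Z (per_X R)), sim a b -> sim (f ∘ a) (f ∘ b).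
Proof.
  split.
  - intros [f' [e1 e2]] Z a b [t [<- <-]].
    exists (f' ∘ t). now rewrite !comp_assoc, e1, e2.
  - intros H. apply (H _ (per_r1 R) (per_r2 R)).
    exists (id _). now rewrite !comp_id_r.
Qed.

(** Choosing a representative in each class turns equations between arrows of the completion into
    [sim] between arrows of [C]; no coherence of the choice is needed, since composites are
    compared only up to [sim]. *)
Definition rep R S (F : @Hom (exact_completion C) R S) : Hom (per_X R) (per_X S) :=
  proj1_sig (constructive_indefinite_description _ (ex_hom_of F)).

Lemma rep_spec R S (F : @Hom (exact_completion C) R S) :
  exists hf : ex_tracked (rep F), F = ex_of hf.
Proof. exact (proj2_sig (constructive_indefinite_description _ (ex_hom_of F))). Qed.

Lemma rep_tracked R S (F : @Hom (exact_completion C) R S) : ex_tracked (rep F).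
Proof. now destruct (rep_spec F). Qed.

Lemma ex_of_rep R S (F : @Hom (exact_completion C) R S) : ex_of (rep_tracked F) = F.
Proof.
  destruct (rep_spec F) as [hf e].
  now rewrite (proof_irrelevance _ (rep_tracked F) hf).
Qed.

Lemma rep_of R S (f : Hom (per_X R) (per_X S)) (hf : ex_tracked f) : sim (rep (ex_of hf)) f.
Proof.
  destruct (rep_spec (ex_of hf)) as [hg e].
  exact (proj1 (ex_of_eq hg hf) (eq_sym e)).
Qed.

Lemma rep_eq R S (F G : @Hom (exact_completion C) R S) : F = G <-> sim (rep F) (rep G).
Proof.
  split; [intros ->; apply sim_refl|].
  intros H. rewrite <- (ex_of_rep F), <- (ex_of_rep G). now apply ex_of_eq.
Qed.

Lemma rep_sim R S (F : @Hom (exact_completion C) R S) Z (a b : Hom Z (per_X R)) :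
  sim a b -> sim (rep F ∘ a) (rep F ∘ b).
Proof. apply tracked_iff, rep_tracked. Qed.

Lemma rep_comp R S T (G : @Hom (exact_completion C) S T) (F : @Hom (exact_completion C) R S) :
  sim (rep (G ∘ F)) (rep G ∘ rep F).
Proof.
  rewrite <- (ex_of_rep G) at 1. rewrite <- (ex_of_rep F) at 1.
  change (sim (rep (ex_comp (ex_of (rep_tracked G)) (ex_of (rep_tracked F))))
              (rep G ∘ rep F)).
  rewrite ex_comp_of. apply rep_of.
Qed.

Lemma rep_comp_at R S T (G : @Hom (exact_completion C) S T) (F : @Hom (exact_completion C) R S)
    Z (a : Hom Z (per_X R)) : sim (rep (G ∘ F) ∘ a) (rep G ∘ (rep F ∘ a)).
Proof. rewrite comp_assoc. apply sim_precomp, rep_comp. Qed.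

Lemma rep_of_at R S (f : Hom (per_X R) (per_X S)) (hf : ex_tracked f) Z (a : Hom Z (per_X R)) :
  sim (rep (ex_of hf) ∘ a) (f ∘ a).
Proof. apply sim_precomp, rep_of. Qed.

Lemma rep_id_at R Z (a : Hom Z (per_X R)) :
  sim (rep (id (R : Obj (exact_completion C))) ∘ a) a.
Proof.
  apply (sim_trans (rep_of_at (ex_tracked_id R) a)). rewrite comp_id_l. apply sim_refl.
Qed.

End Representatives.

#[local] Instance rep_proper (C : Category) (R S : pseudo_eqrel C)
    (F : @Hom (exact_completion C) R S) (Z : Obj C) :
  Proper (@sim C R Z ==> @sim C S Z) (@comp C _ _ _ (rep F)).
Proof. intros a b. apply rep_sim. Qed.

(** * Pseudo equivalence relations from comprehensible ones *)

Section PerOfRelation.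
Variable C : Category.
Hypothesis weak_lims : has_weak_finite_limits C.

Section Span.
Variables (W K : Obj C) (k1 k2 : Hom K W).

Let rel Z (a b : Hom Z W) : Prop := exists t, k1 ∘ t = a /\ k2 ∘ t = b.

Hypothesis rel_refl : forall Z (a : Hom Z W), rel a a.
Hypothesis rel_sym : forall Z (a b : Hom Z W), rel a b -> rel b a.
Hypothesis rel_trans : forall Z (a b c : Hom Z W), rel a b -> rel b c -> rel a c.

Lemma rel_generic : rel k1 k2.
Proof. exists (id K). now rewrite !comp_id_r. Qed.

Lemma rel_pseudo_trans : exists (T : Obj C) (a b tau : Hom T K),
  is_weak_pullback k2 k1 a b /\ k1 ∘ tau = k1 ∘ a /\ k2 ∘ tau = k2 ∘ b.
Proof.
  destruct (weak_pullback weak_lims k2 k1) as [T [a [b [e lift]]]].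
  destruct (@rel_trans T (k1 ∘ a) (k2 ∘ a) (k2 ∘ b)) as [tau Htau].
  - now exists a.
  - rewrite e. now exists b.
  - now exists T, a, b, tau.
Qed.

(** The carrier is [W] by computation, so that arrows into [W] are elements of the new object. *)
Definition per_of_span : pseudo_eqrel C :=
  {| per_r1 := k1; per_r2 := k2;
     per_refl := rel_refl (id W);
     per_sym := rel_sym rel_generic;
     per_trans := rel_pseudo_trans |}.

End Span.

(** The source of all objects of the completion built below: each is given by its elements and an
    equivalence between them. *)
Lemma per_of_comprehensible (W : Obj C) (E : forall Z, Hom Z W -> Hom Z W -> Prop) :
  (forall Z a, E Z a a) ->
  (forall Z a b, E Z a b -> E Z b a) ->
  (forall Z a b c, E Z a b -> E Z b c -> E Z a c) ->
  comprehensible2 E ->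
  exists K (k1 k2 : Hom K W) hr hs ht, forall Z (a b : Hom Z W),
    sim (R := @per_of_span W K k1 k2 hr hs ht) a b <-> E Z a b.
Proof.
  intros E_refl E_sym E_trans [K [k1 [k2 Hk]]].
  unshelve eexists K, k1, k2, _, _, _.
  - intros Z a. apply Hk, E_refl.
  - intros Z a b H. now apply Hk, E_sym, Hk.
  - intros Z a b c H H'. apply Hk in H, H'. apply Hk. now apply E_trans with b.
  - intros Z a b. symmetry. apply Hk.
Qed.

End PerOfRelation.

(** * Finite limits *)

Section FiniteLimits.
Variable C : Category.
Hypothesis weak_lims : has_weak_finite_limits C.

Lemma per_of_legs (I : Type) (R : I -> pseudo_eqrel C) (L : Obj C)
    (l : forall i, Hom L (per_X (R i))) :
  Finite I ->
  exists K (k1 k2 : Hom K L) hr hs ht, forall Z (a b : Hom Z L),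
    sim (R := @per_of_span C weak_lims L K k1 k2 hr hs ht) a b <->
    forall i, sim (l i ∘ a) (l i ∘ b).
Proof.
  intros HI.
  apply (@per_of_comprehensible C weak_lims L
    (fun Z a b => forall i, sim (l i ∘ a) (l i ∘ b))).
  - intros Z a i. apply sim_refl.
  - intros Z a b H i. now apply sim_sym.
  - intros Z a b c H H' i. now apply sim_trans with (l i ∘ b).
  - apply comprehensible_pair; [exact weak_lims|]. intros P p1 p2.
    apply comprehensible_forall_finite; [exact weak_lims|exact HI|]. intros i.
    apply (@comprehensible_iff C P
      (fun Z c => sim ((l i ∘ p1) ∘ c) ((l i ∘ p2) ∘ c))).
    + intros Z c. now rewrite !comp_assoc.
    + now apply comprehensible_sim.
Qed.

(** In a weak product of the carriers, keep the families that are compatible up to [sim], and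
    identify two families when they agree componentwise up to [sim]. Uniqueness of the mediating
    arrow, missing in [C], holds by that choice of [sim]. *)
Lemma exact_completion_has_finite_limits : has_finite_limits (exact_completion C).
Proof.
  intros J F [HJ Hhom].
  destruct (weak_product_family weak_lims (fun i => per_X (fobj F i)) HJ) as [P [p HP]].
  destruct (@comprehensible_forall_finite C weak_lims (Obj J) P
    (fun i Z c => forall j (a : Hom i j), sim (rep (fmap F a) ∘ (p i ∘ c)) (p j ∘ c)) HJ)
    as [L [l Hl]].
  { intros i. apply comprehensible_forall_finite; [exact weak_lims|exact HJ|]. intros j.
    apply comprehensible_forall_finite; [exact weak_lims|apply Hhom|]. intros a.
    apply (@comprehensible_iff C P
      (fun Z c => sim ((rep (fmap F a) ∘ p i) ∘ c) (p j ∘ c))).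
    - intros Z c. now rewrite !comp_assoc.
    - now apply comprehensible_sim. }
  destruct (@per_of_legs (Obj J) (fobj F) L (fun i => p i ∘ l) HJ)
    as [K [k1 [k2 [hr [hs [ht HE]]]]]].
  set (E := @per_of_span C weak_lims L K k1 k2 hr hs ht) in HE.
  assert (tracked : forall i, ex_tracked (R := E) (S := fobj F i) (p i ∘ l)).
  { intros i. apply tracked_iff. intros Z a b H. now apply HE. }
  exists E, (fun i => ex_of (tracked i)). split.
  - intros i j a. apply rep_eq.
    apply (sim_trans (rep_comp _ _)).
    apply sim_trans with (rep (fmap F a) ∘ (p i ∘ l)); [apply rep_sim, (rep_of (tracked i))|].
    apply sim_trans with (p j ∘ l); [|apply sim_sym, (rep_of (tracked j))].
    apply Hl. exists (id L). apply comp_id_r.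
  - intros M m Hm.
    destruct (HP _ (fun i => rep (m i))) as [c Hc].
    assert (Hcl : exists t, l ∘ t = c).
    { apply Hl. intros i j a. rewrite !Hc.
      apply (sim_trans (sim_sym (rep_comp _ _))). apply rep_eq, Hm. }
    destruct Hcl as [t <-].
    assert (ht' : ex_tracked (R := M) (S := E) t).
    { apply tracked_iff. intros Z a b Hab. apply HE. intros i.
      rewrite !comp_assoc, <- (comp_assoc (p i) l t), Hc. now apply rep_sim. }
    exists (ex_of ht'). split.
    + intros i. apply rep_eq. apply (sim_trans (rep_comp _ _)).
      apply (sim_trans (rep_of_at (tracked i) _)).
      rewrite <- Hc, (comp_assoc (p i) l t).
      apply (proj1 (HE _ _ _) (rep_of ht') i).
    + intros h Hh. apply rep_eq.
      apply (sim_trans (rep_of ht')). apply HE. intros i.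
      rewrite <- comp_assoc, Hc, <- (Hh i).
      apply (sim_trans (rep_comp _ _)), (rep_of_at (tracked i)).
Qed.

End FiniteLimits.

(** * Slices and their products *)

Lemma slice_has_terminal (D : Category) (X : Obj D) :
  exists T : Obj (slice X), is_terminal T.
Proof.
  set (T := {| sl_dom := X; sl_arr := id X |}).
  exists T. intros A.
  assert (e : sl_arr T ∘ sl_arr A = sl_arr A) by apply comp_id_l.
  exists {| sl_homP := e |}. split; [trivial|].
  intros h _. apply slice_hom_eq. simpl.
  rewrite <- (sl_homP h). apply comp_id_l.
Qed.

Section Slices.
Variable C : Category.
Variable X : Obj (exact_completion C).
Implicit Types A B Q : Obj (slice X).

Local Notation gen A := (per_X (sl_dom A)).
Local Notation str A := (rep (sl_arr A)).
Local Notation und h := (rep (sl_hom h)).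

(** [gen A] is the carrier of the domain of [A], [str A] represents its structure map to [X], and
    [und h] represents the arrow that underlies [h]. *)
Lemma str_und A B (h : slice_hom A B) Z (a : Hom Z (gen A)) :
  sim (str B ∘ (und h ∘ a)) (str A ∘ a).
Proof. rewrite <- (sl_homP h). symmetry. apply rep_comp_at. Qed.

Lemma und_eq A B (h k : @Hom (slice X) A B) :
  h = k <-> forall Z (a : Hom Z (gen A)), sim (und h ∘ a) (und k ∘ a).
Proof.
  split; [intros ->; reflexivity|].
  intros H. apply slice_hom_eq, rep_eq.
  rewrite <- (comp_id_r (und h)), <- (comp_id_r (und k)). apply H.
Qed.

Lemma und_comp A B Q (k : @Hom (slice X) B Q) (h : @Hom (slice X) A B) Z (a : Hom Z (gen A)) :
  sim (und (k ∘ h) ∘ a) (und k ∘ (und h ∘ a)).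
Proof. apply rep_comp_at. Qed.

Lemma slice_hom_of A B (f : Hom (gen A) (gen B)) :
  (forall Z (a b : Hom Z (gen A)), sim a b -> sim (f ∘ a) (f ∘ b)) ->
  sim (str B ∘ f) (str A) ->
  exists h : @Hom (slice X) A B, forall Z (a : Hom Z (gen A)), sim (und h ∘ a) (f ∘ a).
Proof.
  intros Hf e. apply tracked_iff in Hf.
  assert (e' : @comp (exact_completion C) _ _ _ (sl_arr B) (ex_of Hf) = sl_arr A).
  { apply rep_eq. apply (sim_trans (rep_comp _ _)).
    apply sim_trans with (str B ∘ f); [apply rep_sim, rep_of|exact e]. }
  exists {| sl_homP := e' |}. intros Z a. apply (rep_of_at Hf).
Qed.

(** A product in the slice is a pullback over [X]. Elementwise: compatible pairs of elements lift,
    up to [sim], to an element that is unique up to [sim]. Compatibility of the two components of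
    an element of [Q] is part of [q1] and [q2] being arrows of the slice. *)
Definition is_sim_pullback A B Q (q1 : @Hom (slice X) Q A) (q2 : @Hom (slice X) Q B) : Prop :=
  (forall Z (a : Hom Z (gen A)) (b : Hom Z (gen B)), sim (str A ∘ a) (str B ∘ b) ->
    exists c : Hom Z (gen Q), sim (und q1 ∘ c) a /\ sim (und q2 ∘ c) b) /\
  (forall Z (c c' : Hom Z (gen Q)),
    sim (und q1 ∘ c) (und q1 ∘ c') -> sim (und q2 ∘ c) (und q2 ∘ c') -> sim c c').

Lemma sim_pullback_is_product A B Q (q1 : @Hom (slice X) Q A) (q2 : @Hom (slice X) Q B) :
  is_sim_pullback q1 q2 -> is_product q1 q2.
Proof.
  intros [lift mono] Z a b.
  destruct (lift _ (und a) (und b)) as [c [c1 c2]].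
  { rewrite <- (comp_id_r (und a)), <- (comp_id_r (und b)), !str_und. reflexivity. }
  assert (c1' : forall T (x : Hom T (gen Z)), sim (und q1 ∘ (c ∘ x)) (und a ∘ x)).
  { intros T x. rewrite comp_assoc. now apply sim_precomp. }
  assert (c2' : forall T (x : Hom T (gen Z)), sim (und q2 ∘ (c ∘ x)) (und b ∘ x)).
  { intros T x. rewrite comp_assoc. now apply sim_precomp. }
  destruct (@slice_hom_of Z Q c) as [h Hh].
  - intros T x y e. apply mono; rewrite ?c1', ?c2', e; reflexivity.
  - rewrite <- (str_und q1), c1, <- (comp_id_r (und a)), str_und, comp_id_r. reflexivity.
  - exists h. split.
    + split; apply und_eq; intros T x; rewrite und_comp, Hh; auto.
    + intros k [<- <-]. apply und_eq. intros T x. rewrite Hh.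
      apply mono; rewrite ?c1', ?c2', und_comp; reflexivity.
Qed.

Hypothesis weak_lims : has_weak_finite_limits C.

Lemma sim_pullback_exists A B :
  exists Q (q1 : @Hom (slice X) Q A) (q2 : @Hom (slice X) Q B), is_sim_pullback q1 q2.
Proof.
  destruct (@comprehensible_pair C weak_lims _ _ (fun Z a b => sim (str A ∘ a) (str B ∘ b)))
    as [W [p1 [p2 HW]]].
  { intros P p1 p2.
    apply (@comprehensible_iff C P
      (fun Z c => sim ((str A ∘ p1) ∘ c) ((str B ∘ p2) ∘ c))).
    - intros Z c. now rewrite !comp_assoc.
    - now apply comprehensible_sim. }
  destruct (@per_of_comprehensible C weak_lims W
    (fun Z c c' => sim (p1 ∘ c) (p1 ∘ c') /\ sim (p2 ∘ c) (p2 ∘ c')))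
    as [K [k1 [k2 [hr [hs [ht HE]]]]]].
  - split; reflexivity.
  - now intros Z a b [-> ->].
  - now intros Z a b c [-> ->] [-> ->].
  - apply comprehensible_pair; [exact weak_lims|]. intros P r1 r2.
    apply (@comprehensible_iff C P (fun Z c =>
      sim ((p1 ∘ r1) ∘ c) ((p1 ∘ r2) ∘ c) /\ sim ((p2 ∘ r1) ∘ c) ((p2 ∘ r2) ∘ c))).
    + intros Z c. now rewrite !comp_assoc.
    + now apply comprehensible_and; [exact weak_lims|..]; apply comprehensible_sim.
  - set (E := @per_of_span C weak_lims W K k1 k2 hr hs ht) in HE.
    assert (t1 : forall Z (a b : Hom Z (per_X E)), sim a b -> sim (p1 ∘ a) (p1 ∘ b))
      by (intros; now apply HE).
    assert (t2 : forall Z (a b : Hom Z (per_X E)), sim a b -> sim (p2 ∘ a) (p2 ∘ b))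
      by (intros; now apply HE).
    assert (t0 : ex_tracked (R := E) (S := X) (str A ∘ p1)).
    { apply tracked_iff. intros Z a b e. rewrite <- !comp_assoc. now apply rep_sim, t1. }
    set (Q := {| sl_dom := E : Obj (exact_completion C); sl_arr := ex_of t0 |}).
    assert (square : sim (str A ∘ p1) (str B ∘ p2)).
    { apply HW. exists (id W). now rewrite !comp_id_r. }
    destruct (@slice_hom_of Q A p1 t1) as [q1 Hq1].
    { symmetry. apply (rep_of t0). }
    destruct (@slice_hom_of Q B p2 t2) as [q2 Hq2].
    { apply (sim_trans (sim_sym square)). symmetry. apply (rep_of t0). }
    exists Q, q1, q2. split.
    + intros Z a b e. apply HW in e. destruct e as [c [<- <-]].
      exists c. split; [apply Hq1|apply Hq2].
    + intros Z c c'. rewrite !Hq1, !Hq2. intros e1 e2. now apply HE.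
Qed.

(** An arbitrary product is isomorphic to the constructed one, and the elementwise property is
    transported along the isomorphism. *)
Lemma product_is_sim_pullback A B Q (q1 : @Hom (slice X) Q A) (q2 : @Hom (slice X) Q B) :
  is_product q1 q2 -> is_sim_pullback q1 q2.
Proof.
  intros HQ. destruct (sim_pullback_exists A B) as [Q' [p1 [p2 HQ']]].
  destruct (sim_pullback_is_product HQ' q1 q2) as [i [[i1 i2] _]].
  destruct (HQ _ p1 p2) as [j [[j1 j2] _]].
  assert (ji : @comp (slice X) _ _ _ j i = id Q).
  { destruct (HQ _ q1 q2) as [k [_ Hk]].
    rewrite <- (Hk (id Q)) by (split; apply comp_id_r).
    symmetry. apply Hk. rewrite !comp_assoc, j1, j2. now split. }
  destruct HQ' as [lift mono]. split.
  - intros Z a b e. destruct (lift Z a b e) as [c [c1 c2]].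
    exists (und j ∘ c). rewrite <- !und_comp, j1, j2. now split.
  - intros Z c c' e1 e2.
    assert (back : forall d : Hom Z (gen Q), sim (und j ∘ (und i ∘ d)) d).
    { intros d. rewrite <- und_comp, ji. apply rep_id_at. }
    rewrite <- (back c), <- (back c').
    apply rep_sim, mono; rewrite <- !und_comp, ?i1, ?i2; assumption.
Qed.

End Slices.

(** * Consequences of dependent full diagrams *)

Section TotalRelations.
Variable C : Category.
Hypothesis weak_lims : has_weak_finite_limits C.
Hypothesis dep_full : has_dependent_full_diagrams C.

(** Here a dependent full diagram is used as the fullness principle of constructive set theory: over
    [X] there is a family [U] of codes, each code carrying a total relation between the fibre of
    [A] and the fibre of [B], such that every total relation contains a coded one. An element of
    [V] over a code is a pair in the relation coded by it, with components [α] and [β].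

    The conclusion is an inclusion because a full diagram only maps the pairs coded along [h] to
    pairs of the competing diagram. *)
Lemma full_total_relations (X A B : pseudo_eqrel C)
    (f : Hom (per_X A) (per_X X)) (g : Hom (per_X B) (per_X X)) :
  exists (U V : Obj C) (u : Hom U (per_X X)) (p : Hom V U)
      (α : Hom V (per_X A)) (β : Hom V (per_X B)),
    sim (f ∘ α) (u ∘ p) /\ sim (g ∘ β) (u ∘ p) /\
    (forall Z (e : Hom Z U) (a : Hom Z (per_X A)), sim (u ∘ e) (f ∘ a) ->
      exists v, p ∘ v = e /\ α ∘ v = a) /\
    (forall (N : Obj C) (n : Hom N (per_X X))
        (Rel : forall T, Hom T N -> Hom T (per_X A) -> Hom T (per_X B) -> Prop),
      (forall T T' (s : Hom T' T) ζ a b, Rel T ζ a b -> Rel T' (ζ ∘ s) (a ∘ s) (b ∘ s)) ->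
      (forall T ζ a b, Rel T ζ a b -> sim (g ∘ b) (n ∘ ζ)) ->
      (forall T ζ a, sim (n ∘ ζ) (f ∘ a) -> exists b, Rel T ζ a b) ->
      exists h : Hom N U, u ∘ h = n /\
        forall T (ζ : Hom T N) (v : Hom T V), p ∘ v = h ∘ ζ -> Rel T ζ (α ∘ v) (β ∘ v)).
Proof.
  destruct (@comprehensible_pair C weak_lims _ _
    (fun Z x a => sim x (f ∘ a))) as [M [mx [ma HM]]].
  { intros P p1 p2. apply (@comprehensible_iff C P (fun Z c => sim (p1 ∘ c) ((f ∘ p2) ∘ c))).
    - intros Z c. now rewrite comp_assoc.
    - now apply comprehensible_sim. }
  destruct (@comprehensible_pair C weak_lims _ _
    (fun Z m b => sim (g ∘ b) (mx ∘ m))) as [Y [ym [yb HY]]].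
  { intros P p1 p2.
    apply (@comprehensible_iff C P (fun Z c => sim ((g ∘ p2) ∘ c) ((mx ∘ p1) ∘ c))).
    - intros Z c. now rewrite !comp_assoc.
    - now apply comprehensible_sim. }
  assert (genM : sim mx (f ∘ ma)) by (apply HM; exists (id M); now rewrite !comp_id_r).
  assert (genY : sim (g ∘ yb) (mx ∘ ym)) by (apply HY; exists (id Y); now rewrite !comp_id_r).
  (* [M] consists of the elements of [A] placed in a fibre of [X], [Y] of the candidate values for
     them; a section of [Y] over a fibre of [M] is a total relation. *)
  destruct (dep_full ym mx) as [[U V u p p2 s es wpb] full].
  exists U, V, u, p, (ma ∘ p2), (yb ∘ s).
  pose proof (proj1 wpb) as square. pose proof (proj2 wpb) as lift.
  split; [|split; [|split]].
  - rewrite square, comp_assoc. symmetry. now apply sim_precomp.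
  - rewrite square, <- es, !comp_assoc. now apply sim_precomp.
  - intros Z e a H. apply HM in H. destruct H as [m [m1 m2]].
    destruct (lift Z e m) as [v [v1 v2]]; [now rewrite m1|].
    exists v. now rewrite <- comp_assoc, v2.
  - intros N n Rel Rel_stable Rel_over Rel_total.
    destruct (weak_pullback weak_lims n mx) as [V' [p1' [p2' Hwpb]]].
    (* Totality at the generic argument picks values for all arguments at once. *)
    destruct (Rel_total V' p1' (ma ∘ p2')) as [b Hb].
    { rewrite (proj1 Hwpb), comp_assoc. now apply sim_precomp. }
    assert (Hs : exists s' : Hom V' Y, ym ∘ s' = p2' /\ yb ∘ s' = b).
    { apply HY. rewrite <- (proj1 Hwpb). now apply Rel_over with (ma ∘ p2'). }
    destruct Hs as [s' [s1 s2]].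
    destruct (full {| dd_section := s1; dd_wpb := Hwpb |})
      as [h [P [q [r [k [Pwpb [eh [e1 [e2 e3]]]]]]]]].
    simpl in *. exists h. split; [exact eh|].
    intros T ζ v ev. destruct (proj2 Pwpb T v ζ ev) as [t [t1 t2]].
    pose proof (Rel_stable _ _ (k ∘ t) _ _ _ Hb) as H.
    rewrite <- s2 in H.
    rewrite <- !comp_assoc in H. rewrite <- !comp_assoc.
    rewrite (comp_assoc p1'), e1, t2 in H.
    rewrite (comp_assoc p2'), e2, <- comp_assoc, t1 in H.
    rewrite (comp_assoc s'), e3, <- comp_assoc, t1 in H. exact H.
Qed.

(** With [k1] and [k2] both identities the predicate says that the relation coded by [κ] is
    single-valued; with [k1], [k2] a pair of codes of single-valued relations it says that the
    two relations agree. *)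
Lemma comprehensible_same_values (A B : pseudo_eqrel C) (U V K : Obj C) (p : Hom V U)
    (α : Hom V (per_X A)) (β : Hom V (per_X B)) (k1 k2 : Hom K U) :
  comprehensible (fun Z (κ : Hom Z K) =>
    forall T (s : Hom T Z) (v v' : Hom T V),
      p ∘ v = k1 ∘ (κ ∘ s) -> p ∘ v' = k2 ∘ (κ ∘ s) -> sim (α ∘ v) (α ∘ v') ->
      sim (β ∘ v) (β ∘ v')).
Proof.
  destruct (weak_pullback weak_lims k1 p) as [N1 [n1 [v1 [e1 lift1]]]].
  destruct (weak_pullback weak_lims k2 p) as [N2 [n2 [v2 [e2 lift2]]]].
  destruct (@comprehensible_pair C weak_lims N1 N2 (fun Z c c' =>
      n1 ∘ c = n2 ∘ c' /\ sim (α ∘ (v1 ∘ c)) (α ∘ (v2 ∘ c')))) as [M [m1 [m2 HM]]].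
  { intros P p1 p2. apply (@comprehensible_iff C P (fun Z c =>
      (n1 ∘ p1) ∘ c = (n2 ∘ p2) ∘ c /\
      sim ((α ∘ v1 ∘ p1) ∘ c) ((α ∘ v2 ∘ p2) ∘ c))).
    - intros Z c. now rewrite !comp_assoc.
    - apply comprehensible_and; [exact weak_lims| |].
      + now apply comprehensible_eq.
      + now apply comprehensible_sim. }
  assert (genM : n1 ∘ m1 = n2 ∘ m2 /\ sim (α ∘ (v1 ∘ m1)) (α ∘ (v2 ∘ m2)))
    by (apply HM; exists (id M); now rewrite !comp_id_r).
  destruct genM as [eM sM].
  apply (@comprehensible_iff C K (fun Z κ => forall T (s : Hom T Z) (c : Hom T M),
    (n1 ∘ m1) ∘ c = κ ∘ s -> sim ((β ∘ v1 ∘ m1) ∘ c) ((β ∘ v2 ∘ m2) ∘ c))).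
  - intros Z κ; split; intros H T s.
    + intros v v' ev ev' e.
      destruct (lift1 T (κ ∘ s) v (eq_sym ev)) as [c [c1 <-]].
      destruct (lift2 T (κ ∘ s) v' (eq_sym ev')) as [c' [c1' <-]].
      assert (Hc : exists t : Hom T M, m1 ∘ t = c /\ m2 ∘ t = c')
        by (apply HM; split; [congruence|exact e]).
      destruct Hc as [t [<- <-]].
      specialize (H T s t). rewrite <- !comp_assoc in H. now apply H.
    + intros c e.
      rewrite <- !comp_assoc. apply (H T s).
      * rewrite <- e, !comp_assoc. now rewrite e1.
      * rewrite <- e, eM, !comp_assoc. now rewrite e2.
      * rewrite !comp_assoc in sM. rewrite !comp_assoc. now apply sim_precomp.
  - apply comprehensible_forall_along; [exact weak_lims|exact dep_full|].
    now apply comprehensible_sim.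
Qed.

End TotalRelations.

(** * Functional relations and exponentials in slices *)

Section Exponentials.
Variable C : Category.
Hypothesis weak_lims : has_weak_finite_limits C.
Hypothesis dep_full : has_dependent_full_diagrams C.
Variable X : Obj (exact_completion C).

Local Notation gen A := (per_X (sl_dom A)).
Local Notation str A := (rep (sl_arr A)).
Local Notation und h := (rep (sl_hom h)).

Definition relation_over (N A B : Obj (slice X)) : Type :=
  forall T : Obj C, Hom T (gen N) -> Hom T (gen A) -> Hom T (gen B) -> Prop.

(** The graphs of the arrows [N × A -> B] of the slice, described without a product of [N] and [A]:
    see [graph_functional] and [functional_is_graph]. *)
Record is_functional (N A B : Obj (slice X)) (Rel : relation_over N A B) : Prop := {
  fun_precomp : forall T T' (s : Hom T' T) ζ a b,
    Rel T ζ a b -> Rel T' (ζ ∘ s) (a ∘ s) (b ∘ s);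
  fun_over_l : forall T ζ a b, Rel T ζ a b -> sim (str N ∘ ζ) (str A ∘ a);
  fun_over_r : forall T ζ a b, Rel T ζ a b -> sim (str N ∘ ζ) (str B ∘ b);
  fun_total : forall T ζ a, sim (str N ∘ ζ) (str A ∘ a) -> exists b, Rel T ζ a b;
  fun_resp : forall T ζ ζ' a a' b b', Rel T ζ a b -> sim ζ ζ' -> sim a a' -> sim b b' ->
    Rel T ζ' a' b';
  fun_unique : forall T ζ ζ' a a' b b', Rel T ζ a b -> Rel T ζ' a' b' ->
    sim ζ ζ' -> sim a a' -> sim b b'
}.

Arguments fun_unique {N A B Rel} _ {T ζ ζ' a a' b b'}.
Arguments fun_resp {N A B Rel} _ {T ζ ζ' a a' b b'}.

(** Both relations are total on the same domain, and a single-valued relation has no room for pairs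
    beyond those of a total one that it contains. *)
Lemma functional_antisym (N A B : Obj (slice X)) (Rel Rel' : relation_over N A B) :
  is_functional Rel -> is_functional Rel' ->
  (forall T ζ a b, Rel T ζ a b -> Rel' T ζ a b) ->
  forall T ζ a b, Rel' T ζ a b -> Rel T ζ a b.
Proof.
  intros H H' le T ζ a b r.
  destruct (fun_total H (fun_over_l H' r)) as [b' r'].
  apply (fun_resp H r'); [reflexivity ..|].
  apply (fun_unique H' (le _ _ _ _ r') r); reflexivity.
Qed.

Lemma functional_reindex (N E A B : Obj (slice X)) (h : @Hom (slice X) N E)
    (Rel : relation_over E A B) :
  is_functional Rel ->
  is_functional (N := N) (A := A) (B := B) (fun T ζ a b => Rel T (und h ∘ ζ) a b).
Proof.
  intros H. split.
  - intros T T' s ζ a b r. rewrite comp_assoc. now apply (fun_precomp H).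
  - intros T ζ a b r. rewrite <- (str_und h). exact (fun_over_l H r).
  - intros T ζ a b r. rewrite <- (str_und h). exact (fun_over_r H r).
  - intros T ζ a e. apply (fun_total H). now rewrite str_und.
  - intros T ζ ζ' a a' b b' r e. apply (fun_resp H r). now apply rep_sim.
  - intros T ζ ζ' a a' b b' r r' e. apply (fun_unique H r r'). now apply rep_sim.
Qed.

Definition graph (N A B Q : Obj (slice X)) (q1 : @Hom (slice X) Q N) (q2 : @Hom (slice X) Q A)
    (g : @Hom (slice X) Q B) : relation_over N A B :=
  fun T ζ a b => exists c : Hom T (gen Q),
    sim (und q1 ∘ c) ζ /\ sim (und q2 ∘ c) a /\ sim (und g ∘ c) b.

Lemma graph_functional (N A B Q : Obj (slice X)) (q1 : @Hom (slice X) Q N)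
    (q2 : @Hom (slice X) Q A) (g : @Hom (slice X) Q B) :
  is_sim_pullback q1 q2 -> is_functional (graph q1 q2 g).
Proof.
  intros [lift mono]. split.
  - intros T T' s ζ a b [c [c1 [c2 c3]]]. exists (c ∘ s).
    rewrite !comp_assoc. auto using sim_precomp.
  - intros T ζ a b [c [c1 [c2 c3]]]. now rewrite <- c1, <- c2, !str_und.
  - intros T ζ a b [c [c1 [c2 c3]]]. now rewrite <- c1, <- c3, !str_und.
  - intros T ζ a e. destruct (lift T ζ a e) as [c [c1 c2]].
    exists (und g ∘ c), c. now split; [|split].
  - intros T ζ ζ' a a' b b' [c [c1 [c2 c3]]] eζ ea eb.
    exists c. now rewrite c1, c2, c3.
  - intros T ζ ζ' a a' b b' [c [c1 [c2 c3]]] [c' [c1' [c2' c3']]] eζ ea.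
    rewrite <- c3, <- c3'. apply rep_sim, mono; [now rewrite c1, c1'|now rewrite c2, c2'].
Qed.

(** Conversely, the value of a functional relation at the generic argument [(q1, q2)] is an arrow of
    [C], and single-valuedness makes it an arrow of the completion. *)
Lemma functional_is_graph (N A B Q : Obj (slice X)) (q1 : @Hom (slice X) Q N)
    (q2 : @Hom (slice X) Q A) (Rel : relation_over N A B) :
  is_functional Rel ->
  exists g : @Hom (slice X) Q B,
    forall T (c : Hom T (gen Q)), Rel T (und q1 ∘ c) (und q2 ∘ c) (und g ∘ c).
Proof.
  intros H. destruct (fun_total H (ζ := und q1) (a := und q2)) as [b Hb].
  { rewrite <- (comp_id_r (und q1)), <- (comp_id_r (und q2)), !str_und. reflexivity. }
  destruct (@slice_hom_of C X Q B b) as [g Hg].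
  - intros T c c' e.
    apply (fun_unique H (fun_precomp H c Hb) (fun_precomp H c' Hb)); now apply rep_sim.
  - rewrite <- (fun_over_r H Hb), <- (comp_id_r (und q1)), str_und, comp_id_r. reflexivity.
  - exists g. intros T c.
    apply (fun_resp H (fun_precomp H c Hb)); [reflexivity ..|]. now rewrite Hg.
Qed.

(** The function object, presented by the functional relation [Gr] that it carries. Its elements are
    those codes of total relations that code a single-valued one, and two codes are identified when
    they lie over the same element of [X] and code the same function. A functional relation [Rel]
    contains a coded total relation; being contained in [Rel], that one is single-valued, and by
    [functional_antisym] it is all of [Rel]. *)
Lemma functional_relation_classifier (A B : Obj (slice X)) :
  exists (E : Obj (slice X)) (Gr : relation_over E A B),
    is_functional Gr /\
    forall (N : Obj (slice X)) (Rel : relation_over N A B), is_functional Rel ->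
      exists! h : @Hom (slice X) N E,
        forall T ζ a b, Gr T (und h ∘ ζ) a b <-> Rel T ζ a b.
Proof.
  destruct (full_total_relations weak_lims dep_full (str A) (str B))
    as [U [V [u [p [α [β [eα [eβ [total full]]]]]]]]].
  destruct (comprehensible_same_values weak_lims dep_full p α β (id U) (id U))
    as [W [w Hw]].
  (* [W] consists of the codes of single-valued relations. For two of them, agreeing on common
     arguments is the relation below; single-valuedness is its reflexivity. *)
  set (same_graph := fun Z (e e' : Hom Z W) => forall T (s : Hom T Z) (v v' : Hom T V),
    p ∘ v = w ∘ (e ∘ s) -> p ∘ v' = w ∘ (e' ∘ s) -> sim (α ∘ v) (α ∘ v') ->
    sim (β ∘ v) (β ∘ v')).
  assert (same_graph_refl : forall Z e, same_graph Z e e).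
  { intros Z e T s v v' ev ev'.
    apply (proj2 (Hw _ w) (ex_intro _ (id W) (comp_id_r w)) T (e ∘ s));
      now rewrite comp_id_l. }
  (* Codes over the same element of [X] have relations with the same domain. *)
  assert (total' : forall Z (e e' : Hom Z W) T (s : Hom T Z) (v : Hom T V),
    sim ((u ∘ w) ∘ e) ((u ∘ w) ∘ e') -> p ∘ v = w ∘ (e ∘ s) ->
    exists v', p ∘ v' = w ∘ (e' ∘ s) /\ α ∘ v' = α ∘ v).
  { intros Z e e' T s v H ev. apply total.
    transitivity ((u ∘ w) ∘ e ∘ s).
    - rewrite !comp_assoc. symmetry. now apply sim_precomp.
    - rewrite <- !comp_assoc, <- ev, !comp_assoc. symmetry. now apply sim_precomp. }
  destruct (@per_of_comprehensible C weak_lims W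
    (fun Z e e' => sim ((u ∘ w) ∘ e) ((u ∘ w) ∘ e') /\ same_graph Z e e'))
    as [K [k1 [k2 [hr [hs [ht HE]]]]]].
  - intros Z e. split; [reflexivity|apply same_graph_refl].
  - intros Z e e' [H L]. split; [now symmetry|].
    intros T s v v' ev ev' ea. symmetry. apply (L T s); [assumption ..|now symmetry].
  - intros Z e1 e2 e3 [H12 L12] [H23 L23]. split; [now rewrite H12|].
    intros T s v v'' ev ev'' ea.
    destruct (total' _ _ _ _ s v H12 ev) as [v' [ev' ea']].
    transitivity (β ∘ v').
    + apply (L12 T s); [assumption ..|now rewrite ea'].
    + apply (L23 T s); [assumption ..|now rewrite ea'].
  - apply comprehensible_pair; [exact weak_lims|]. intros P p1 p2.
    apply (@comprehensible_iff C P (fun Z c =>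
      sim ((u ∘ w ∘ p1) ∘ c) ((u ∘ w ∘ p2) ∘ c) /\
      forall T (s : Hom T Z) (v v' : Hom T V),
        p ∘ v = (w ∘ p1) ∘ (c ∘ s) -> p ∘ v' = (w ∘ p2) ∘ (c ∘ s) ->
        sim (α ∘ v) (α ∘ v') -> sim (β ∘ v) (β ∘ v'))).
    + intros Z c. unfold same_graph.
      rewrite <- !comp_assoc.
      split; intros [H L]; (split; [exact H|]); intros T s v v' ev ev';
        apply (L T s); rewrite <- ?comp_assoc in *; assumption.
    + apply comprehensible_and; [exact weak_lims| |].
      * now apply comprehensible_sim.
      * now apply comprehensible_same_values.
  - set (R := @per_of_span C weak_lims W K k1 k2 hr hs ht) in HE.
    assert (tr : ex_tracked (R := R) (S := X) (u ∘ w)).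
    { apply tracked_iff. intros Z e e' H. now apply HE. }
    set (E := {| sl_dom := R : Obj (exact_completion C); sl_arr := ex_of tr |}).
    assert (strE : forall T (e : Hom T W), sim (str E ∘ e) ((u ∘ w) ∘ e))
      by exact (rep_of_at tr).
    set (Gr := fun T (e : Hom T W) a b =>
      exists v : Hom T V, p ∘ v = w ∘ e /\ sim (α ∘ v) a /\ sim (β ∘ v) b).
    assert (HGr : is_functional (N := E) (A := A) (B := B) Gr).
    { split.
      - intros T T' s e a b [v [ev [va vb]]]. exists (v ∘ s).
        rewrite !comp_assoc, ev. auto using sim_precomp.
      - intros T e a b [v [ev [va _]]].
        rewrite (strE T e), <- va, <- comp_assoc, <- ev, !comp_assoc.
        symmetry. now apply sim_precomp.
      - intros T e a b [v [ev [_ vb]]].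
        rewrite (strE T e), <- vb, <- comp_assoc, <- ev, !comp_assoc.
        symmetry. now apply sim_precomp.
      - intros T e a H. destruct (total T (w ∘ e) a) as [v [v1 v2]].
        + rewrite comp_assoc, <- H. symmetry. apply (strE T e).
        + exists (β ∘ v), v. rewrite v2. now split; [|split].
      - intros T e e' a a' b b' [v [ev [va vb]]] ee ea eb.
        apply HE in ee. destruct ee as [H L].
        destruct (total' _ e e' T (id T) v H) as [v' [ev' ea']]; [now rewrite comp_id_r|].
        exists v'. split; [now rewrite comp_id_r in ev'|]. split.
        + now rewrite ea', va.
        + rewrite <- eb, <- vb. symmetry.
          apply (L T (id T)); [now rewrite comp_id_r|exact ev'|now rewrite ea'].
      - intros T e e' a a' b b' [v [ev [va vb]]] [v' [ev' [va' vb']]] ee ea.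
        apply HE in ee. destruct ee as [H L].
        rewrite <- vb, <- vb'.
        apply (L T (id T)); [now rewrite comp_id_r ..|now rewrite va, va']. }
    exists E, Gr. split; [exact HGr|].
    intros N Rel HRel.
    (* [h0] picks a code of a total relation contained in [Rel], hence of a single-valued one. *)
    destruct (full _ (str N) Rel) as [h0 [uh0 Hh0]].
    + apply (fun_precomp HRel).
    + intros T ζ a b r. symmetry. exact (fun_over_r HRel r).
    + apply (fun_total HRel).
    + assert (Ht : exists t, w ∘ t = h0).
      { apply Hw. intros T s v v' ev ev' ea.
        rewrite comp_id_l in ev, ev'.
        apply (fun_unique HRel (Hh0 _ _ _ ev) (Hh0 _ _ _ ev')); [reflexivity|exact ea]. }
      destruct Ht as [t <-].
      destruct (@slice_hom_of C X N E t) as [h Hh].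
      { intros T ζ ζ' eζ. apply HE. split.
        - rewrite !comp_assoc, <- (comp_assoc u), uh0. now apply rep_sim.
        - intros T' s v v' ev ev' ea.
          rewrite !comp_assoc, <- comp_assoc in ev, ev'.
          apply (fun_unique HRel (Hh0 _ _ _ ev) (Hh0 _ _ _ ev'));
            [now apply sim_precomp|exact ea]. }
      { rewrite (strE _ t), <- comp_assoc, uh0. reflexivity. }
      assert (le : forall T ζ a b, Gr T (und h ∘ ζ) a b -> Rel T ζ a b).
      { intros T ζ a b r.
        destruct (fun_resp HGr r (Hh T ζ) (reflexivity a) (reflexivity b))
          as [v [ev [va vb]]].
        rewrite comp_assoc in ev.
        apply (fun_resp HRel (Hh0 _ _ _ ev)); [reflexivity|assumption ..]. }
      exists h. split.
      * intros T ζ a b. split; [apply le|].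
        exact (functional_antisym (functional_reindex h HGr) HRel le (b := b)).
      * intros h' Hh'. apply und_eq. intros T ζ. apply HE. split.
        { rewrite <- (strE _ (und h ∘ ζ)), <- (strE _ (und h' ∘ ζ)), !str_und. reflexivity. }
        intros T' s v v' ev ev' ea.
        assert (r : Gr T' (und h ∘ (ζ ∘ s)) (α ∘ v) (β ∘ v))
          by (exists v; rewrite (comp_assoc (und h)); now split).
        assert (r' : Gr T' (und h' ∘ (ζ ∘ s)) (α ∘ v') (β ∘ v'))
          by (exists v'; rewrite (comp_assoc (und h')); now split).
        apply (fun_unique HRel (le _ _ _ _ r) (proj1 (Hh' _ _ _ _) r'));
          [reflexivity|exact ea].
Qed.

(** An arrow [g : Q -> B] is its graph, which is classified by a unique [h : N -> E]. The evaluation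
    is the function whose graph is the universal relation [Gr], so transposing by [h] means
    exactly that [Gr] reindexed along [h] is the graph of [g]. *)
Lemma slice_exponential (A B : Obj (slice X)) :
  exists (E P : Obj (slice X)) (p1 : Hom P E) (p2 : Hom P A) (ev : Hom P B),
    is_exponential p1 p2 ev.
Proof.
  destruct (functional_relation_classifier A B) as [E [Gr [HGr univ]]].
  destruct (sim_pullback_exists weak_lims E A) as [P [p1 [p2 HP]]].
  destruct (functional_is_graph p1 p2 HGr) as [ev Hev].
  apply sim_pullback_is_product in HP.
  exists E, P, p1, p2, ev. split; [exact HP|].
  intros N Q q1 q2 HQ g.
  apply (product_is_sim_pullback weak_lims) in HQ.
  pose proof (graph_functional g HQ) as Hg.
  assert (key : forall h : @Hom (slice X) N E,
    (exists m : Hom Q P, p1 ∘ m = h ∘ q1 /\ p2 ∘ m = q2 /\ ev ∘ m = g) <->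
    (forall T ζ a b, Gr T (und h ∘ ζ) a b <-> graph q1 q2 g ζ a b)).
  { intros h. split.
    - intros [m [m1 [m2 m3]]].
      assert (le : forall T ζ a b, graph q1 q2 g ζ a b -> Gr T (und h ∘ ζ) a b).
      { intros T ζ a b [c [c1 [c2 c3]]].
        apply (fun_resp HGr (Hev T (und m ∘ c))).
        - now rewrite <- und_comp, m1, und_comp, c1.
        - now rewrite <- und_comp, m2.
        - now rewrite <- und_comp, m3. }
      intros T ζ a b. split; [|apply le].
      exact (functional_antisym Hg (functional_reindex h HGr) le (b := b)).
    - intros H.
      destruct (HP _ (h ∘ q1) q2) as [m [[m1 m2] _]].
      exists m. split; [exact m1|split; [exact m2|]].
      apply und_eq. intros T c. rewrite und_comp.
      assert (r : Gr T (und h ∘ (und q1 ∘ c)) (und q2 ∘ c) (und g ∘ c)).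
      { apply H. exists c. now split; [|split]. }
      apply (fun_unique HGr (Hev T (und m ∘ c)) r); rewrite <- !und_comp.
      + now rewrite m1.
      + now rewrite m2. }
  destruct (univ N _ Hg) as [h [h1 h2]].
  exists h. split; [now apply key|].
  intros h' Hh'. now apply h2, key.
Qed.

End Exponentials.

(** * Local cartesian closure *)

Theorem theorem3p7 (C : Category)
  (weak_lims : has_weak_finite_limits C)
  (dep_full : has_dependent_full_diagrams C) :
  locally_cartesian_closed (exact_completion C).
Proof.
  split; [now apply exact_completion_has_finite_limits|].
  intros X. split; [|split].
  - apply slice_has_terminal.
  - intros A B. destruct (sim_pullback_exists weak_lims A B) as [Q [q1 [q2 HQ]]].
    exists Q, q1, q2. now apply sim_pullback_is_product.
  - intros A B. now apply slice_exponential.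
Qed.
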